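(* For any lattice $\mathcal{L} \subset \mathbb{R}^n$ and any vector $\mathbf{x} \in \mathbb{R}^n$, we have the positive semidefinite inequality \[ \frac{Hf_{\mathcal{L}}(\mathbf{x})}{f_{\mathcal{L}}(\mathbf{x})} \succeq Hf_{\mathcal{L}} (\mathbf{0}) + \frac{\nabla f_{\mathcal{L}}(\mathbf{x}) (\nabla f_{\mathcal{L}}(\mathbf{x}))^T}{f_{\mathcal{L}}(\mathbf{x})^2} . \]
   Context: A lattice $\mathcal{L}\subset\mathbb{R}^n$ is the set of all integer linear combinations of $n$ linearly independent vectors of $\mathbb{R}^n$. For $\mathbf{x}\in\mathbb{R}^n$, $\rho(\mathbf{x}) = \exp(-\pi \|\mathbf{x}\|^2)$ with $\|\cdot\|$ the Euclidean norm, and for a discrete set $A\subset\mathbb{R}^n$, $\rho(A) = \sum_{\mathbf{w}\in A}\rho(\mathbf{w})$. The periodic Gaussian function is $f_{\mathcal{L}}(\mathbf{x}) = \rho(\mathcal{L}+\mathbf{x})/\rho(\mathcal{L})$. $\nabla f$ denotes the gradient (a column vector) and $Hf$ the Hessian matrix of $f$. For symmetric matrices, $A\succeq B$ means that $A-B$ is positive semidefinite. *)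

(* Defs.v *)
From mathcomp Require Import all_boot all_order all_algebra.
From mathcomp Require Import all_classical all_reals all_analysis.

Set Implicit Arguments.
Unset Strict Implicit.
Unset Printing Implicit Defensive.
Import Order.TTheory GRing.Theory Num.Theory.
Import numFieldNormedType.Exports.

Local Open Scope classical_set_scope.
Local Open Scope ring_scope.

Definition is_lattice (R : realType) (n : nat) (L : set 'cV[R]_n) : Prop :=
  exists2 b : n.-tuple 'cV[R]_n, free b &
    L = [set v | exists z : 'I_n -> int, v = \sum_(i < n) b`_i *~ z i].

(* The norm [`| x |] of the library on matrices is the sup norm, hence this
   separate definition; both induce the same topology and derivatives. *)
Definition enorm (R : realType) (n : nat) (x : 'cV[R]_n) : R :=
  Num.sqrt (\sum_(i < n) x i 0 ^+ 2).

Definition rho (R : realType) (n : nat) (x : 'cV[R]_n) : R :=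
  expR (- pi * enorm x ^+ 2).

(* The sum is taken in the extended reals and sent back to [R] by [fine], which
   maps [+oo] to [0]; translates of lattices have a finite sum. *)
Definition rho_set (R : realType) (n : nat) (A : set 'cV[R]_n) : R :=
  fine (\esum_(w in A) (rho w)%:E).

Definition translate (R : realType) (n : nat) (L : set 'cV[R]_n)
    (x : 'cV[R]_n) : set 'cV[R]_n :=
  [set w + x | w in L].

Definition periodic_gaussian (R : realType) (n : nat) (L : set 'cV[R]_n)
    (x : 'cV[R]_n) : R :=
  rho_set (translate L x) / rho_set L.

Definition partial (R : realType) (n : nat) (i : 'I_n) (f : 'cV[R]_n -> R)
    (x : 'cV[R]_n) : R :=
  'D_(delta_mx i 0) f x.

Definition gradient (R : realType) (n : nat) (f : 'cV[R]_n -> R)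
    (x : 'cV[R]_n) : 'cV[R]_n :=
  \col_(i < n) partial i f x.

Definition hessian (R : realType) (n : nat) (f : 'cV[R]_n -> R)
    (x : 'cV[R]_n) : 'M[R]_n :=
  \matrix_(i < n, j < n) partial i (partial j f) x.

Definition psdmx (R : realType) (n : nat) (M : 'M[R]_n) : Prop :=
  M^T = M /\ forall v : 'cV[R]_n, 0 <= (v^T *m M *m v) 0 0.

Definition loewner_ge (R : realType) (n : nat) (A B : 'M[R]_n) : Prop :=
  psdmx (A - B).

(* Main.v *)
(** Since |w + x|^2 = |w|^2 + 2 w.x + |x|^2, one has f(x) = rho(x) Z(x) / Z(0),
    where Z(x) = \sum_(w in L) rho(w) exp(- 2 pi w.x) is a Laplace transform; the
    factor rho(x) cancels from the inequality, which becomes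
    D^2(log Z)(x) >= D^2(log Z)(0).

    In Z(x) Z(y), substitute (w, w') |-> (w + w', w - w'): the image consists of the
    pairs of lattice vectors congruent modulo 2L, so the parallelogram law gives
    Z(x) Z(y) = \sum_k P_k(x + y) P_k(x - y), where k ranges over L / 2L.
    Cauchy-Schwarz, and the same identity at (x + y, 0) and (x - y, 0), yield
    Z(x)^2 Z(y)^2 <= Z(0)^2 Z(x + y) Z(x - y).  For y = t v this is an equality at
    t = 0, and comparing second derivatives there gives the claim. *)

Require Import Defs.
From mathcomp Require Import all_boot all_order all_algebra.
From mathcomp Require Import all_classical all_reals all_analysis.
From mathcomp Require Import ring lra zify.
Import Order.TTheory GRing.Theory Num.Theory.
Import numFieldNormedType.Exports.
Set Implicit Arguments.
Unset Strict Implicit.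
Unset Printing Implicit Defensive.
Local Open Scope classical_set_scope.
Local Open Scope ring_scope.

(** * Unordered sums of real families *)

Lemma esumZl (R : realType) (T : choiceType) (D : set T) (k : R)
    (a : T -> \bar R) : 0 <= k -> (forall x, (0 <= a x)%E) ->
  \esum_(x in D) (k%:E * a x)%E = (k%:E * \esum_(x in D) a x)%E.
Proof.
move=> k0 a0.
have sub (k' : R) (a' : T -> \bar R) : 0 <= k' -> (forall x, (0 <= a' x)%E) ->
    (\esum_(x in D) (k'%:E * a' x) <= k'%:E * \esum_(x in D) a' x)%E.
  move=> k'0 a'0; apply: ge_ereal_sup => _ [X [finX XD] <-].
  rewrite -ge0_mule_fsumr//.
  by rewrite lee_wpmul2l ?lee_fin//; apply: ereal_sup_ubound; exists X.
apply/eqP; rewrite eq_le sub//=.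
have [->|kn0] := eqVneq k 0.
  rewrite mul0e; apply: esum_ge0 => x _.
  by rewrite mul0e.
have kp : 0 < k by rewrite lt_def kn0.
(* The reverse inequality is [sub] for the factor [k^-1] and the family [k * a]. *)
rewrite muleC -lee_pdivlMr// [leRHS]muleC.
have := sub k^-1 (fun x => (k%:E * a x)%E).
rewrite invr_ge0 k0 => /(_ isT).
have -> : \esum_(x in D) (k^-1%:E * (k%:E * a x))%E = \esum_(x in D) a x.
  by apply: eq_esum => x _; rewrite muleA -EFinM mulVf// mul1e.
by apply => x; rewrite mule_ge0// lee_fin.
Qed.

Lemma le_esum_fin (R : realType) (T : choiceType) (D : set T)
    (a : T -> \bar R) (B : R) :
  (forall s : seq T, uniq s -> (\sum_(x <- s) a x <= B%:E)%E) ->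
  (\esum_(x in D) a x <= B%:E)%E.
Proof.
move=> H; apply: ge_ereal_sup => _ [X [finX XD] <-].
by rewrite fsbig_finite//=; apply: H.
Qed.

(** Meant for nonnegative summable families: a divergent sum gets the default value 0 from
    [fine]. *)
Definition psum (R : realType) (T : choiceType) (a : T -> R) : R :=
  fine (\esum_(x in [set: T]) (a x)%:E).

Definition asum (R : realType) (T : choiceType) (a : T -> R) : Prop :=
  (\esum_(x in [set: T]) `|a x|%:E < +oo)%E.

(** Signed families are summed through their positive and negative parts, since [\esum] is suited to
    nonnegative terms. *)
Definition rsum (R : realType) (T : choiceType) (a : T -> R) : R :=
  psum (fun x => Num.max (a x) 0) - psum (fun x => Num.max (- a x) 0).

Section Sums.
Context {R : realType} {T : choiceType}.
Implicit Types a b : T -> R.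

Lemma asum_le a b : asum b -> (forall x, `|a x| <= `|b x|) -> asum a.
Proof.
by move=> sb ab; apply: le_lt_trans sb; apply: le_esum => x _; rewrite lee_fin.
Qed.

Lemma asum_esum a : asum a -> (forall x, 0 <= a x) ->
  \esum_(x in [set: T]) (a x)%:E = (psum a)%:E.
Proof.
move=> sa a0; rewrite /psum fineK// ge0_fin_numE; last first.
  by apply: esum_ge0 => x _; rewrite lee_fin.
by move: sa; congr (_ < +oo)%E; apply: eq_esum => x _; rewrite ger0_norm.
Qed.

Lemma asumD a b : asum a -> asum b -> asum (fun x => a x + b x).
Proof.
move=> sa sb; apply: le_lt_trans (lte_add_pinfty sa sb).
rewrite -esumD; [|by move=> *; rewrite lee_fin..].
by apply: le_esum => x _; rewrite -EFinD lee_fin ler_normD.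
Qed.

Lemma asumZ a k : asum a -> asum (fun x => k * a x).
Proof.
move=> sa; rewrite /asum.
under eq_esum do rewrite normrM EFinM.
rewrite esumZl// lte_mul_pinfty ?lee_fin//.
Qed.

Lemma asum_pos a : asum a -> asum (fun x => Num.max (a x) 0).
Proof.
move=> /asum_le; apply => x; rewrite ger0_norm ?le_max ?lexx ?orbT//.
by rewrite ge_max normr_ge0 ler_norm.
Qed.

Lemma asumN a : asum a -> asum (fun x => - a x).
Proof. by move=> /asum_le; apply => x; rewrite normrN. Qed.

Lemma psumD a b : asum a -> asum b ->
  (forall x, 0 <= a x) -> (forall x, 0 <= b x) ->
  psum (fun x => a x + b x) = psum a + psum b.
Proof.
move=> sa sb a0 b0; apply: EFin_inj; rewrite EFinD -!asum_esum//.
- by rewrite -esumD// => x _; rewrite lee_fin.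
- exact: asumD.
- by move=> x; rewrite addr_ge0.
Qed.

Lemma psumZ a k : 0 <= k -> (forall x, 0 <= a x) ->
  asum a -> psum (fun x => k * a x) = k * psum a.
Proof.
move=> k0 a0 sa; apply: EFin_inj; rewrite EFinM -!asum_esum//.
- by rewrite -esumZl// => x _; rewrite lee_fin.
- exact: asumZ.
- by move=> x; rewrite mulr_ge0.
Qed.

Lemma le_psum a b : asum a -> asum b -> (forall x, 0 <= a x) ->
  (forall x, a x <= b x) -> psum a <= psum b.
Proof.
move=> sa sb a0 ab; rewrite -lee_fin -!asum_esum//.
  by apply: le_esum => x _; rewrite lee_fin.
by move=> x; exact: le_trans (ab x).
Qed.

Lemma psum_ge0 a : (forall x, 0 <= a x) -> 0 <= psum a.
Proof. by move=> a0; apply/fine_ge0/esum_ge0 => x _; rewrite lee_fin. Qed.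

Lemma max0_ge0 (r : R) : 0 <= Num.max r 0.
Proof. by rewrite le_max lexx orbT. Qed.

(** If a = p - q, then p plus the negative part of a equals q plus its positive part, and [psum] is
    additive on nonnegative families. Linearity of [rsum] follows by choosing convenient p and q. *)
Lemma rsumE a p q : (forall x, a x = p x - q x) -> asum p -> asum q ->
  (forall x, 0 <= p x) -> (forall x, 0 <= q x) -> rsum a = psum p - psum q.
Proof.
move=> E sp sq p0 q0.
have sa : asum a.
  by apply: asum_le (asumD sp (asumN sq)) _ => x; rewrite E.
apply/eqP; rewrite /rsum subr_eq addrAC eq_sym subr_eq -!psumD //;
  try (exact: asum_pos || exact: asum_pos (asumN sa) || by move=> x; exact: max0_ge0).
apply/eqP; congr psum; apply/funext => x; rewrite E.
by case: (leP (p x - q x) 0) => h1; case: (leP (- (p x - q x)) 0) => h2; lra.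
Qed.

Lemma ge0_rsum a : asum a -> (forall x, 0 <= a x) -> rsum a = psum a.
Proof.
move=> sa a0; rewrite (@rsumE a a (fun=> 0)) //.
- by rewrite [psum (fun=> 0)]/psum esum1 ?subr0.
- by move=> x; rewrite subr0.
- by rewrite /asum esum1 ?ltry// => x _; rewrite normr0.
Qed.

Lemma rsumD a b : asum a -> asum b ->
  rsum (fun x => a x + b x) = rsum a + rsum b.
Proof.
move=> sa sb.
have [p1 p2] := (asum_pos sa, asum_pos sb).
have [n1 n2] := (asum_pos (asumN sa), asum_pos (asumN sb)).
rewrite (@rsumE _ (fun x => Num.max (a x) 0 + Num.max (b x) 0)
  (fun x => Num.max (- a x) 0 + Num.max (- b x) 0)).
- by rewrite !psumD/rsum; [ring|by []|by []|move=> x;exact: max0_ge0..| | |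
    move=> x;exact: max0_ge0 | move=> x; exact: max0_ge0].
- by move=> x; case: (leP (a x) 0) => h1; case: (leP (b x) 0) => h2;
    case: (leP (-a x) 0) => h3; case: (leP (-b x) 0) => h4; lra.
- exact: asumD.
- exact: asumD.
- by move=> x; rewrite addr_ge0 ?max0_ge0.
- by move=> x; rewrite addr_ge0 ?max0_ge0.
Qed.

Lemma rsumN a : asum a -> rsum (fun x => - a x) = - rsum a.
Proof.
by move=> sa; rewrite /rsum opprB; congr (_ - psum _); apply/funext => x; rewrite opprK.
Qed.

Lemma rsumZ k a : asum a -> rsum (fun x => k * a x) = k * rsum a.
Proof.
wlog k0 : k / 0 <= k.
  move=> H sa; case: (leP 0 k) => [/H->//|/ltW kn].
  rewrite -[k in RHS]opprK mulNr -H ?oppr_ge0// -rsumN; last exact: asumZ.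
  by congr rsum; apply/funext => x; rewrite mulNr opprK.
move=> sa; have [p1 n1] := (asum_pos sa, asum_pos (asumN sa)).
rewrite (@rsumE _ (fun x => k * Num.max (a x) 0) (fun x => k * Num.max (- a x) 0)).
- by rewrite !psumZ ?mulrBr//; move=> x; exact: max0_ge0.
- by move=> x; case: (leP (a x) 0) => h1; case: (leP (-a x) 0) => h2;
    rewrite -?mulrBr; [have -> : a x = 0 by lra| | |];
    rewrite ?mulr0 ?subr0 ?sub0r ?mulrN ?opprK//; lra.
- exact: asumZ.
- exact: asumZ.
- by move=> x; rewrite mulr_ge0 ?max0_ge0.
- by move=> x; rewrite mulr_ge0 ?max0_ge0.
Qed.

Lemma asum_sum (J : Type) (r : seq J) (c : J -> T -> R) :
  (forall j, asum (c j)) -> asum (fun x => \sum_(j <- r) c j x).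
Proof.
move=> sc; elim: r => [|j r IH].
  by rewrite /asum esum1 ?ltry// => x _; rewrite big_nil normr0.
by under eq_fun do rewrite big_cons; exact: asumD.
Qed.

Lemma rsum_sum (J : Type) (r : seq J) (c : J -> T -> R) :
  (forall j, asum (c j)) ->
  rsum (fun x => \sum_(j <- r) c j x) = \sum_(j <- r) rsum (c j).
Proof.
move=> sc; elim: r => [|j r IH].
  rewrite big_nil /rsum; apply/eqP; rewrite subr_eq0; apply/eqP; congr psum.
  by apply/funext => x; rewrite big_nil oppr0.
under eq_fun do rewrite big_cons.
by rewrite rsumD ?IH ?big_cons//; exact: asum_sum.
Qed.

(** The sums of the positive and of the negative part both lie in [0, psum b], hence so does the
    absolute value of their difference. *)
Lemma ler_norm_rsum a b : asum b -> (forall x, `|a x| <= b x) ->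
  `|rsum a| <= psum b.
Proof.
move=> sb ab.
have sa : asum a.
  by apply: asum_le sb _ => x; rewrite (le_trans (ab x))// ler_norm.
have ap := asum_pos sa; have an := asum_pos (asumN sa).
have b0 x : 0 <= b x by exact: le_trans (ab x).
have pp := psum_ge0 (fun x => max0_ge0 (a x)).
have pn := psum_ge0 (fun x => max0_ge0 (- a x)).
have h1 : psum (fun x => Num.max (a x) 0) <= psum b.
  apply: le_psum => // x; first exact: max0_ge0.
  by rewrite ge_max b0 (le_trans (ler_norm _)).
have h2 : psum (fun x => Num.max (- a x) 0) <= psum b.
  apply: le_psum => // x; first exact: max0_ge0.
  by rewrite ge_max b0 (le_trans (ler_norm _))// normrN.
by rewrite /rsum ler_norml; apply/andP; split; lra.
Qed.

End Sums.

(** * One-variable and directional calculus *)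

Lemma norm_expR_sub_1D (R : realType) (s : R) :
  `|expR s - 1 - s| <= s ^+ 2 * expR `|s|.
Proof.
have h1 := expR_ge1Dx s.
(* This is 1 - s <= expR (- s) multiplied by expR s; it serves both signs of [s]. *)
have h2 : expR s - 1 <= s * expR s.
  have := expR_ge1Dx (- s); rewrite -(ler_pM2r (expR_gt0 s)) -expRD addNr expR0.
  by rewrite mulrDl mul1r mulNr; lra.
rewrite ger0_norm; last by lra.
have [s0|s0] := leP 0 s.
  have : s * (expR s - 1) <= s * (s * expR s) by rewrite ler_wpM2l.
  by rewrite ger0_norm// expr2 -mulrA; lra.
have e1 : 1 <= expR `|s| by rewrite -expR0 ler_expR.
have : s ^+ 2 * 1 <= s ^+ 2 * expR `|s| by rewrite ler_wpM2l ?sqr_ge0.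
have : - s * (1 - expR s) <= - s * - s by rewrite ler_wpM2l//; lra.
by rewrite mulr1 expr2; lra.
Qed.

(** A quadratic remainder bound can be summed term by term, which makes this criterion suitable for
    differentiating series. *)
Lemma is_derive_quad (R : realType) (V : normedModType R) (f : V -> R) (x v : V)
    (d C : R) :
  (forall h : R, `|h| <= 1 -> `|f (h *: v + x) - f x - h * d| <= C * h ^+ 2) ->
  is_derive x v f d.
Proof.
move=> H.
have lim : (fun h : R => h^-1 *: ((f \o shift x) (h *: v) - f x)) @ 0^' --> d.
  apply/cvgrPdist_le => e e0; near=> h.
  have hn0 : h != 0 by near: h; exact: nbhs_dnbhs_neq.
  have h1 : `|h| <= 1.
    by near: h; apply: dnbhs0_le.
  (* The denominator stays positive whatever the sign of [C], zero included. *)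
  have h2 : `|h| <= e / (`|C| + 1).
    by near: h; apply: dnbhs0_le; rewrite divr_gt0// ltr_wpDl.
  rewrite distrC /=.
  have -> : h^-1 *: (f (h *: v + x) - f x) - d =
            h^-1 * (f (h *: v + x) - f x - h * d).
    by rewrite /GRing.scale/= [in RHS]mulrBr mulrA mulVf// mul1r.
  rewrite normrM normfV ler_pdivrMl ?normr_gt0// (le_trans (H _ h1))//.
  rewrite -[h ^+ 2]real_normK ?num_real// expr2 mulrCA ler_wpM2l//.
  apply: (@le_trans _ _ ((`|C| + 1) * `|h|)).
    by rewrite ler_wpM2r// (le_trans (ler_norm _))// lerDl.
  by rewrite mulrC -ler_pdivlMr// ltr_wpDl.
apply: DeriveDef; first by apply/cvg_ex; exists d.
exact: cvg_lim lim.
Unshelve. all: by end_near. Qed.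

(** The two difference quotients are the same function of [h]. This lemma and its converse at t = 0
    pass between directional and one-variable derivatives. *)
Lemma is_derive_along (R : realType) (V : normedModType R) (f : V -> R) (x v : V)
    (t d : R) : is_derive (t *: v + x) v f d ->
  is_derive t 1 (fun t => f (t *: v + x)) d.
Proof.
have E : (fun h : R => h^-1 *: ((f \o shift (t *: v + x)) (h *: v) - f (t *: v + x)))
  = (fun h : R => h^-1 *: (((fun t => f (t *: v + x)) \o shift t) (h *: 1) - f (t *: v + x))).
  by apply/funext => h /=; rewrite [h *: 1]mulr1 scalerDl addrA.
move=> [D1 D2]; apply: DeriveDef; first by move: D1; rewrite /derivable E.
by move: D2; rewrite /derive E.
Qed.

Lemma is_derive_of_line (R : realType) (V : normedModType R) (f : V -> R) (x v : V)
    (d : R) : is_derive (0 : R) 1 (fun t => f (t *: v + x)) d ->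
  is_derive x v f d.
Proof.
have E : (fun h : R => h^-1 *: ((f \o shift x) (h *: v) - f x))
  = (fun h : R => h^-1 *: (((fun t => f (t *: v + x)) \o shift 0) (h *: 1) - f (0 *: v + x))).
  by apply/funext => h /=; rewrite [h *: 1]mulr1 addr0 scale0r add0r.
move=> [D1 D2]; apply: DeriveDef; first by move: D1; rewrite /derivable -E.
by move: D2; rewrite /derive -E.
Qed.

(** At the minimum f' 0 = 0. If d were negative, f' would be negative just to the right of 0, and
    the mean value theorem would give a value of f below f 0. *)
Lemma second_derive_at_min (R : realType) (f f' : R -> R) (d : R) :
  (forall t : R, is_derive t 1 f (f' t)) -> is_derive (0 : R) 1 f' d ->
  (forall t, f 0 <= f t) -> 0 <= d.
Proof.
move=> df df' fmin; rewrite leNgt; apply/negP => d0.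
have m0 : (0 : R) \in `](-1), 1[%R by rewrite in_itv/= ltr01 oppr_lt0 ltr01.
have f'0 : f' 0 = 0.
  have := @derive1_at_min R f (-1) 1 0 _ _ m0.
  have -> // : is_true (-1 <= 1 :> R) by lra.
  move=> /(_ isT) H.
  have [_ E] := H (fun t _ => @ex_derive _ _ _ _ _ _ _ (df t)) (fun t _ => fmin t).
  by have [_ E'] := df 0; rewrite -E' E.
case: df' => /[dup] D1 /cvg_ex [l hl] D2.
have {hl} : (fun h : R => h^-1 *: ((f' \o shift 0) (h *: 1) - f' 0)) @ 0^' --> d.
  by rewrite -D2; exact: D1.
move=> /cvgrPdist_lt /(_ (- d)); rewrite oppr_gt0 => /(_ d0).
move=> [e /= e0 He].
have [c cab Hc] : exists2 c, c \in `]0, e / 2[%R & f (e / 2) - f 0 = f' c * (e / 2 - 0).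
  apply: MVT => //; first by rewrite divr_gt0.
  apply: continuous_subspaceT => t; apply/differentiable_continuous.
  by apply/derivable1_diffP; exact: (@ex_derive _ _ _ _ _ _ _ (df t)).
have c0 : 0 < c by rewrite (itvP cab).
have ce : c < e.
  have : c < e / 2 by rewrite (itvP cab).
  by move: e0; lra.
have := He c; rewrite /= sub0r normrN gtr0_norm// => /(_ ce).
rewrite gt_eqF// => /(_ isT) /=.
rewrite [c *: 1]mulr1 addr0 f'0 subr0 => H.
have fc : f' c < 0.
  rewrite ltNge; apply/negP => fc0.
  have q0 : 0 <= c^-1 *: f' c by rewrite /GRing.scale/= mulr_ge0// invr_ge0 ltW.
  by move: H; rewrite ltr0_norm; lra.
have := fmin (e / 2); rewrite -subr_ge0 Hc subr0 leNgt => /negP; apply.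
by rewrite nmulr_rlt0// divr_gt0.
Qed.

(** * Dot product and l1 norm *)

Definition cvdot (R : realType) (n : nat) (u x : 'cV[R]_n) : R :=
  \sum_(i < n) u i 0 * x i 0.

Definition norm1 (R : realType) (n : nat) (u : 'cV[R]_n) : R :=
  \sum_(i < n) `|u i 0|.

Section Dot.
Context {R : realType} {n : nat}.
Implicit Types u v x y : 'cV[R]_n.

Lemma cvdotDr u x y : cvdot u (x + y) = cvdot u x + cvdot u y.
Proof. by rewrite /cvdot -big_split; apply: eq_bigr => i _; rewrite mxE mulrDr. Qed.

Lemma cvdotZr u k x : cvdot u (k *: x) = k * cvdot u x.
Proof. by rewrite /cvdot mulr_sumr; apply: eq_bigr => i _; rewrite mxE mulrCA. Qed.

Lemma cvdotDl u v x : cvdot (u + v) x = cvdot u x + cvdot v x.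
Proof. by rewrite /cvdot -big_split; apply: eq_bigr => i _; rewrite mxE mulrDl. Qed.

Lemma cvdotZl u k x : cvdot (k *: u) x = k * cvdot u x.
Proof. by rewrite /cvdot mulr_sumr; apply: eq_bigr => i _; rewrite mxE mulrA. Qed.

Lemma cvdot0 u : cvdot u 0 = 0.
Proof. by rewrite /cvdot big1// => i _; rewrite mxE mulr0. Qed.

Lemma cvdot_delta u i : cvdot u (delta_mx i 0) = u i 0.
Proof.
rewrite /cvdot (bigD1 i)//= big1 ?addr0; first by rewrite mxE !eqxx mulr1.
by move=> j ji; rewrite mxE (negPf ji) mulr0.
Qed.

Lemma norm1_ge0 u : 0 <= norm1 u.
Proof. exact: sumr_ge0. Qed.

(** Each coordinate of [x] is at most [norm1 x] in absolute value. For fixed [x] the bound is linear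
    in [norm1 u], the form that [rapidM] asks for. *)
Lemma norm_cvdot_le u x : `|cvdot u x| <= norm1 x * norm1 u.
Proof.
rewrite (le_trans (ler_norm_sum _ _ _))// /norm1 big_distrr/=.
apply: ler_sum => i _; rewrite normrM mulrC ler_wpM2r//.
by rewrite (bigD1 i)//= lerDl sumr_ge0.
Qed.

End Dot.

(** * Laplace transforms of rapidly decaying weights *)

Section Laplace.
Context {R : realType} {n : nat} {T : choiceType} (u : T -> 'cV[R]_n).
Hypothesis hu : exists K, asum (fun z => expR (- K * norm1 (u z))).
Implicit Types (c g : T -> R) (x v : 'cV[R]_n).

(* Decay faster than every exponential of the frequency, the class of weights
   that is stable under the tilts [expR (u . x)] and the factors [u . v] coming
   from derivatives. *)
Definition rapid c := forall K, exists2 C, 0 <= C &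
  forall z, `|c z| <= C * expR (- K * norm1 (u z)).

Lemma rapid_asum c : rapid c -> asum c.
Proof.
case: hu => K hK /(_ K) [C C0 hC]; apply: asum_le (asumZ C hK) _ => z.
by rewrite (le_trans (hC z))// ler_norm.
Qed.

(** The growth rate [B] is absorbed by using the decay of [c] at rate K + B. *)
Lemma rapidM c g B : rapid c -> (forall z, `|g z| <= expR (B * norm1 (u z))) ->
  rapid (fun z => c z * g z).
Proof.
move=> rc hg K; have [C C0 hC] := rc (K + B); exists C => // z.
rewrite normrM (le_trans (ler_pM _ _ (hC z) (hg z)))//.
by rewrite -mulrA -expRD; have -> : - (K + B) * norm1 (u z) + B * norm1 (u z) =
  - K * norm1 (u z) by ring.
Qed.

Lemma rapid_abs c : rapid c -> rapid (fun z => `|c z|).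
Proof.
move=> rc K; have [C C0 hC] := rc K; exists C => // z.
by rewrite normr_id.
Qed.

Lemma rapid_expR c x : rapid c -> rapid (fun z => c z * expR (cvdot (u z) x)).
Proof.
move=> rc; apply: (@rapidM _ _ (norm1 x) rc) => z.
rewrite ger0_norm ?expR_ge0// ler_expR (le_trans (ler_norm _))//.
exact: norm_cvdot_le.
Qed.

Lemma rapid_expR_norm c x : rapid c ->
  rapid (fun z => c z * expR `|cvdot (u z) x|).
Proof.
move=> rc; apply: (@rapidM _ _ (norm1 x) rc) => z.
by rewrite ger0_norm ?expR_ge0// ler_expR norm_cvdot_le.
Qed.

Lemma rapid_dot c x : rapid c -> rapid (fun z => c z * cvdot (u z) x).
Proof.
move=> rc; apply: (@rapidM _ _ (norm1 x) rc) => z.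
apply: le_trans (expR_ge1Dx _).
by rewrite (le_trans (norm_cvdot_le _ _))// lerDr.
Qed.

Definition laplace c x : R := rsum (fun z => c z * expR (cvdot (u z) x)).

(** Differentiation under the sum: expanding expR (h * a) to first order, with a = u z . v, leaves
    in each term a remainder of at most h^2 [m z], and [m] is summable. *)
Lemma is_derive_laplace c x v : rapid c ->
  is_derive x v (laplace c) (laplace (fun z => c z * cvdot (u z) v) x).
Proof.
move=> rc.
pose m z := `|c z * expR (cvdot (u z) x) * cvdot (u z) v * cvdot (u z) v
   * expR `|cvdot (u z) v| |.
have rm : rapid m.
  exact/rapid_abs/rapid_expR_norm/rapid_dot/rapid_dot/rapid_expR.
apply: (@is_derive_quad _ _ _ _ _ _ (psum m)) => h h1.
have a1 := rapid_asum (rapid_expR (h *: v + x) rc).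
have a2 := rapid_asum (rapid_expR x rc).
have a3 := rapid_asum (rapid_expR x (rapid_dot v rc)).
rewrite /laplace -rsumZ// -rsumN// -rsumD//; last exact: asumN.
rewrite -rsumN; last exact: asumZ.
rewrite -rsumD; [|exact: asumD (asumN _)|exact/asumN/asumZ].
rewrite mulrC -psumZ ?sqr_ge0//; [|by move=> z; exact: normr_ge0|exact: rapid_asum].
apply: ler_norm_rsum; first exact/asumZ/rapid_asum.
move=> z; rewrite cvdotDr cvdotZr expRD.
set a := cvdot (u z) v; set E := expR (cvdot (u z) x).
have -> : c z * (expR (h * a) * E) + - (c z * E) + - (h * (c z * a * E)) =
  (c z * E) * (expR (h * a) - 1 - h * a) by ring.
(* Because |h| <= 1, the factor expR |h a| is at most expR |a|, so the majorant depends on [h] only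
   through h^2. *)
have h2 : `|expR (h * a) - 1 - h * a| <= h ^+ 2 * (`|a| * `|a| * expR `|a|).
  rewrite (le_trans (norm_expR_sub_1D _))// exprMn -[leLHS]mulrA.
  rewrite ler_wpM2l ?sqr_ge0//.
  rewrite -[a ^+ 2]real_normK ?num_real// expr2 ler_wpM2l ?mulr_ge0//.
  by rewrite ler_expR normrM -[leRHS]mul1r ler_wpM2r.
rewrite /m -/a -/E; move: (c z * E) => W.
rewrite !normrM (ger0_norm (expR_ge0 _)) (le_trans (ler_wpM2l (normr_ge0 W) h2))//.
by rewrite le_eqVlt; apply/orP; left; apply/eqP; ring.
Qed.

End Laplace.

(** * Summability over integer vectors *)

Lemma ler_sum_uniq_sub (R : numDomainType) (T : eqType) (s t : seq T) (F : T -> R) :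
  uniq s -> uniq t -> {subset s <= t} -> (forall x, 0 <= F x) ->
  \sum_(x <- s) F x <= \sum_(x <- t) F x.
Proof.
move=> us ut st F0.
have E : perm_eq s [seq x <- t | x \in s].
  apply: uniq_perm => //; first exact: filter_uniq.
  by move=> x; rewrite mem_filter andb_idr// => /st.
rewrite (perm_big _ E) big_filter big_mkcond/=.
by apply: ler_sum => x _; case: ifP.
Qed.

Lemma sum_half_le (R : realFieldType) (N : nat) :
  \sum_(k < N) (2^-1 : R) ^+ k <= 2.
Proof.
have H : \sum_(k < N) (2^-1 : R) ^+ k = 2 - 2 * 2^-1 ^+ N.
  elim: N => [|N IH]; first by rewrite big_ord0 expr0 mulr1 subrr.
  by rewrite big_ord_recr/= IH exprS; field.
by rewrite H gerBl mulr_ge0// exprn_ge0// invr_ge0.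
Qed.

(** The index k stands for the integer k - N in [-N, N); the negative and the nonnegative half are
    each bounded by a geometric sum. *)
Lemma sum_half_absz_le (R : realFieldType) (N : nat) :
  \sum_(k < N + N) (2^-1 : R) ^+ `|(k : nat)%:Z - N%:Z|%N <= 4.
Proof.
rewrite big_split_ord/=.
have h1 : \sum_(i < N) (2^-1 : R) ^+ `|(i : nat)%:Z - N%:Z|%N <= 2.
  rewrite (reindex_inj rev_ord_inj)/=; apply: le_trans (sum_half_le R N).
  apply: ler_sum => i _.
  have -> : `|(N - i.+1)%N%:Z - N%:Z|%N = i.+1 by have := ltn_ord i; lia.
  rewrite exprS ler_piMl ?exprn_ge0 ?invr_ge0//.
  by rewrite invf_le1// ler1n.
have h2 : \sum_(i < N) (2^-1 : R) ^+ `|(N + i)%N%:Z - N%:Z|%N <= 2.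
  apply: le_trans (sum_half_le R N); apply: ler_sum => i _.
  by have -> : `|(N + i)%N%:Z - N%:Z|%N = i by lia.
have -> : (4 : R) = 2 + 2 by lra.
exact: lerD.
Qed.

(** A finite set of integer vectors lies in a cube [-N, N)^n, over which the sum factors into n
    one-dimensional sums, each at most 4. *)
Lemma asum_prod_half (R : realType) (n : nat) :
  asum (fun z : {ffun 'I_n -> int} => \prod_(i < n) (2^-1 : R) ^+ `|z i|%N).
Proof.
pose m (z : {ffun 'I_n -> int}) : R := \prod_(i < n) 2^-1 ^+ `|z i|%N.
have m0 z : 0 <= m z by apply: prodr_ge0 => i _; rewrite exprn_ge0// invr_ge0.
apply: (@le_lt_trans _ _ (4 ^+ n)%:E); last exact: ltry.
apply: le_esum_fin => s us; rewrite sumEFin lee_fin.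
(* The successor makes |z i| < N strict, so that z i + N falls in [0, 2N). *)
pose N := (\max_(z <- s) \max_(i < n) `|z i|%N).+1.
pose code (h : {ffun 'I_n -> 'I_(N + N)}) : {ffun 'I_n -> int} :=
  [ffun i => (h i : nat)%:Z - N%:Z].
have code_inj : injective code.
  move=> h h' /ffunP E; apply/ffunP => i; apply/val_inj => /=.
  by have := E i; rewrite !ffunE => /addIr [].
have sub : {subset s <= [seq code h | h <- enum {: {ffun 'I_n -> 'I_(N + N)}}]}.
  move=> z zs.
  have zN i : (`|z i| < N)%N.
    rewrite /N ltnS; apply: leq_trans (@leq_bigmax _ (fun i => `|z i|%N) i) _.
    exact: (@leq_bigmax_seq _ s xpredT (fun z : {ffun 'I_n -> int} => \max_(i < n) `|z i|%N)).
  have lt i : (`|(z i + N%:Z)%R|%N < N + N)%N by have := zN i; lia.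
  apply/mapP; exists [ffun i => Ordinal (lt i)]; first by rewrite mem_enum.
  apply/ffunP => i; rewrite !ffunE/=; move: (zN i) => zNi;
    rewrite gez0_abs; [rewrite addrK//|].
    move: (z i : int) zNi => y; lia.
have -> : \sum_(z <- s) `|\prod_(i < n) (2^-1 : R) ^+ `|z i|%N| = \sum_(z <- s) m z.
  by apply: eq_bigr => z _; rewrite ger0_norm//; exact: m0.
apply: le_trans (ler_sum_uniq_sub us _ sub m0) _.
  by rewrite map_inj_uniq ?enum_uniq.
rewrite big_map big_enum/=.
have -> : \sum_(h : {ffun 'I_n -> 'I_(N + N)}) m (code h) =
    \prod_(i < n) \sum_(k < N + N) (2^-1 : R) ^+ `|(k : nat)%:Z - N%:Z|%N.
  rewrite bigA_distr_bigA; apply: eq_bigr => h _; apply: eq_bigr => i _.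
  by rewrite ffunE.
rewrite -[n in leRHS]card_ord -prodr_const; apply: ler_prod => i _.
rewrite sum_half_absz_le andbT; apply: sumr_ge0 => k _.
by rewrite exprn_ge0// invr_ge0.
Qed.

(** * Cauchy-Schwarz and the rotation of double sums *)

Lemma sum_mul_sq_le (R : realDomainType) (I : finType) (a b : I -> R) :
  (\sum_i a i * b i) ^+ 2 <= (\sum_i a i ^+ 2) * (\sum_i b i ^+ 2).
Proof.
(* Lagrange's identity: this sum of squares is twice the gap in the Cauchy-Schwarz inequality. *)
have H : 0 <= \sum_i \sum_j (a i * b j - a j * b i) ^+ 2.
  by apply: sumr_ge0 => i _; apply: sumr_ge0 => j _; exact: sqr_ge0.
have E : \sum_i \sum_j (a i * b j - a j * b i) ^+ 2 =
    2 * ((\sum_i a i ^+ 2) * (\sum_i b i ^+ 2)) - 2 * (\sum_i a i * b i) ^+ 2.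
  have -> : 2 * ((\sum_i a i ^+ 2) * (\sum_i b i ^+ 2)) =
    \sum_i \sum_j a i ^+ 2 * b j ^+ 2 + \sum_i \sum_j a j ^+ 2 * b i ^+ 2.
    rewrite mulr_natl mulr2n; congr (_ + _); last rewrite exchange_big/=.
    - by rewrite mulr_suml; apply: eq_bigr => i _; rewrite mulr_sumr.
    - by rewrite mulr_suml; apply: eq_bigr => i _; rewrite mulr_sumr.
  have -> : (\sum_i a i * b i) ^+ 2 = \sum_i \sum_j (a i * b i) * (a j * b j).
    by rewrite expr2 mulr_suml; apply: eq_bigr => i _; rewrite mulr_sumr.
  rewrite mulr_sumr -big_split -sumrB; apply: eq_bigr => i _ /=.
  rewrite mulr_sumr -big_split -sumrB; apply: eq_bigr => j _ /=.
  by ring.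
by move: H; rewrite E; lra.
Qed.

Lemma esum_prod (R : realType) (T1 T2 : choiceType) (a : T1 -> R) (b : T2 -> R) :
  asum a -> asum b -> (forall x, 0 <= a x) -> (forall x, 0 <= b x) ->
  \esum_(k in [set: T1 * T2]) (a k.1 * b k.2)%:E = (psum a * psum b)%:E.
Proof.
move=> sa sb a0 b0.
have -> : [set: T1 * T2] = [set: T1] `*`` (fun=> [set: T2]).
  by apply/seteqP; split => -[].
rewrite -(esum_esum (a := fun x y => (a x * b y)%:E)); last first.
  by move=> x y _ _; rewrite lee_fin mulr_ge0.
under eq_esum.
  move=> x _; under eq_esum do rewrite EFinM.
  rewrite esumZl ?lee_fin// (asum_esum sb b0) muleC.
  over.
by rewrite esumZl ?psum_ge0// (asum_esum sa a0) -EFinM mulrC.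
Qed.

(** The class of [z] in Z^n / 2 Z^n, which is L / 2L once a basis of L is fixed. *)
Definition parity (n : nat) (z : {ffun 'I_n -> int}) : {ffun 'I_n -> bool} :=
  [ffun i => odd `|z i|%N].

Lemma parity_bij (n : nat) :
  set_bij [set: {ffun 'I_n -> int} * {ffun 'I_n -> int}]
    [set k | parity k.1 = parity k.2] (fun k => (k.1 + k.2, k.1 - k.2)).
Proof.
split.
- move=> [a b] _ /=; apply/ffunP => i; rewrite !ffunE.
  move: (a i) (b i) => x y; lia.
- move=> [a b] [a' b'] _ _ /= [/ffunP E1 /ffunP E2].
  congr (_, _); apply/ffunP => i; move: (E1 i) (E2 i); rewrite !ffunE;
    move: (a i) (b i) (a' i) (b' i) => x y x' y'; lia.
- move=> [a b] /= /ffunP E.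
  (* The preimage is ((a + b) / 2, (a - b) / 2); the division is exact because the parities
     agree. *)
  exists ([ffun i => ((a i + b i) %/ 2)%Z], [ffun i => a i - ((a i + b i) %/ 2)%Z]) => //=.
  by congr (_, _); apply/ffunP => i; move: (E i); rewrite !ffunE;
    move: (a i) (b i) => x y; lia.
Qed.

Definition psum_class (R : realType) (n : nat) (p : {ffun 'I_n -> int} -> R)
  (k : {ffun 'I_n -> bool}) : R := psum (fun z => p z * (parity z == k)%:R).

(** By [parity_bij] the double sum runs over pairs of equal parity. Grouped by their common class k,
    these pairs form a product set, on which the sum factors. *)
Lemma psum_mul_rotate (R : realType) (n : nat)
    (a b p q : {ffun 'I_n -> int} -> R) :
  asum a -> asum b -> asum p -> asum q ->
  (forall z, 0 <= a z) -> (forall z, 0 <= b z) ->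
  (forall z, 0 <= p z) -> (forall z, 0 <= q z) ->
  (forall z z', a z * b z' = p (z + z') * q (z - z')) ->
  psum a * psum b = \sum_k psum_class p k * psum_class q k.
Proof.
move=> sa sb sp sq a0 b0 p0 q0 E; apply: EFin_inj.
have cl0 (c : {ffun 'I_n -> int} -> R) k : (forall z, 0 <= c z) ->
    forall z, 0 <= c z * (parity z == k)%:R.
  by move=> c0 z; rewrite mulr_ge0.
have scl (c : {ffun 'I_n -> int} -> R) k : asum c ->
    asum (fun z => c z * (parity z == k)%:R).
  move=> /asum_le; apply => z; rewrite normrM.
  by case: (_ == _); rewrite ?normr1 ?mulr1// normr0 mulr0.
rewrite -esum_prod// -sumEFin.
transitivity (\sum_k \esum_(z in [set: {ffun 'I_n -> int} * {ffun 'I_n -> int}])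
    (p z.1 * (parity z.1 == k)%:R * (q z.2 * (parity z.2 == k)%:R))%:E)%E; last first.
  by apply: eq_bigr => k _; rewrite /psum_class -esum_prod//; (exact: scl || exact: cl0).
rewrite -esum_sum; last first.
  by move=> k j _ _; rewrite lee_fin mulr_ge0//; exact: cl0.
transitivity (\esum_(k in [set k : {ffun 'I_n -> int} * {ffun 'I_n -> int} |
   parity k.1 = parity k.2]) (p k.1 * q k.2)%:E).
  rewrite (reindex_esum _ _ _ _ (parity_bij n)).
  by apply: eq_esum => -[z z'] _ /=; rewrite E.
rewrite esum_mkcond; apply: eq_esum => -[z z'] _ /=.
(* For a fixed pair, only the class of its first component can contribute. *)
rewrite (bigD1 (parity z))//= big1 ?adde0; last first.
  by move=> k; rewrite eq_sym => /negPf ->; rewrite mulr0 mul0r.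
rewrite eqxx mulr1; case: ifPn.
  by rewrite inE/= => ->; rewrite eqxx mulr1.
rewrite notin_setE/= => /eqP; rewrite eq_sym => /negPf ->.
by rewrite !mulr0.
Qed.

Lemma psum_gt0 (R : realType) (T : choiceType) (a : T -> R) (z : T) :
  asum a -> (forall x, 0 <= a x) -> 0 < a z -> 0 < psum a.
Proof.
move=> sa a0 az; rewrite -lte_fin -asum_esum// (@lt_le_trans _ _ (a z)%:E)//.
by apply: esum_ge; exists [set z]; rewrite ?fsbig_set1//; split.
Qed.

(** * Gaussians: decay and derivatives *)

Definition sqnorm (R : realType) (n : nat) (w : 'cV[R]_n) : R :=
  \sum_(i < n) w i 0 ^+ 2.

Section Gauss.
Context {R : realType} {n : nat}.
Implicit Types u v w x y : 'cV[R]_n.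

Lemma rhoE x : rho x = expR (- pi * sqnorm x).
Proof. by rewrite /rho /enorm sqr_sqrtr// sumr_ge0// => i _; exact: sqr_ge0. Qed.

Lemma sqnormD x y : sqnorm (x + y) = sqnorm x + sqnorm y + 2 * cvdot x y.
Proof.
rewrite /sqnorm /cvdot mulr_sumr -!big_split; apply: eq_bigr => i _ /=.
by rewrite mxE; ring.
Qed.

Lemma sqnormZ k x : sqnorm (k *: x) = k ^+ 2 * sqnorm x.
Proof. by rewrite /sqnorm mulr_sumr; apply: eq_bigr => i _; rewrite mxE exprMn. Qed.

Lemma rho0 : rho (0 : 'cV[R]_n) = 1.
Proof.
by rewrite rhoE /sqnorm big1 ?mulr0 ?expR0// => i _; rewrite mxE expr0n.
Qed.

Lemma cvdotC x y : cvdot x y = cvdot y x.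
Proof. by apply: eq_bigr => i _; rewrite mulrC. Qed.

Lemma rhoD w x :
  rho (w + x) = rho x * (rho w * expR (cvdot ((-2 * pi) *: w) x)).
Proof.
rewrite !rhoE -!expRD sqnormD cvdotZl; congr expR; ring.
Qed.

(** Complete the square in each coordinate t: K^2 / (4a) - K |t| + a t^2 is (2a |t| - K)^2 / (4a).
    The n coordinates account for the n-th power. *)
Lemma expR_sqnorm_le (a K : R) w : 0 < a ->
  expR (- a * sqnorm w) <= expR (K ^+ 2 / (4 * a)) ^+ n * expR (- K * norm1 w).
Proof.
move=> a0; rewrite -expRM_natl -expRD ler_expR.
have -> : n%:R * (K ^+ 2 / (4 * a)) = \sum_(i < n) K ^+ 2 / (4 * a).
  by rewrite sumr_const card_ord mulr_natl.
rewrite /norm1 /sqnorm !mulr_sumr -big_split.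
apply: ler_sum => i _ /=; set t := w i 0.
rewrite -[t ^+ 2]real_normK ?num_real// -subr_ge0.
have -> : K ^+ 2 / (4 * a) + - K * `|t| - - a * `|t| ^+ 2 =
   (2 * a * `|t| - K) ^+ 2 / (4 * a) by field; rewrite gt_eqF.
by rewrite divr_ge0 ?sqr_ge0// mulr_ge0// ltW.
Qed.

Lemma is_derive_cvdot x v w : is_derive x v (fun y => cvdot y w) (cvdot v w).
Proof.
apply: (@is_derive_quad _ _ _ _ _ _ 0) => h _.
by rewrite cvdotDl cvdotZl addrK subrr normr0 mul0r.
Qed.

Lemma is_derive_rho x v :
  is_derive x v (@rho R n) (rho x * (-2 * pi * cvdot x v)).
Proof.
apply: is_derive_of_line.
(* Along a line the exponent is a quadratic polynomial in t; it is built from [cst] and [id] so that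
   its derivative can be inferred. *)
pose p : R -> R := cst (- pi * sqnorm v) * (id * id) +
  cst (-2 * pi * cvdot x v) * id + cst (- pi * sqnorm x).
have -> : (fun t : R => rho (t *: v + x)) = expR \o p.
  apply/funext => t; rewrite /p !fctE /= rhoE sqnormD sqnormZ cvdotZl cvdotC.
  by congr expR; ring.
have dp : is_derive (0 : R) 1 p (-2 * pi * cvdot x v).
  apply: is_derive_eq; rewrite !fctE /GRing.scale/=; ring.
apply: is_derive_eq.
by congr (_ * _); rewrite rhoE /p !fctE /=; congr expR; ring.
Qed.

End Gauss.

(** The function k A B - l C^2 has minimum 0 at t = 0; the conclusion says that its second
    derivative there is nonnegative. *)
Lemma second_derive_contact (R : realType) (A A1 B B1 C C1 : R -> R)
    (a2 b2 c2 k l : R) :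
  (forall t : R, is_derive t 1 A (A1 t)) -> is_derive (0 : R) 1 A1 a2 ->
  (forall t : R, is_derive t 1 B (B1 t)) -> is_derive (0 : R) 1 B1 b2 ->
  (forall t : R, is_derive t 1 C (C1 t)) -> is_derive (0 : R) 1 C1 c2 ->
  (forall t, l * (C t * C t) <= k * (A t * B t)) ->
  l * (C 0 * C 0) = k * (A 0 * B 0) ->
  l * (2 * C 0 * c2 + 2 * C1 0 ^+ 2) <=
    k * (A 0 * b2 + B 0 * a2 + 2 * A1 0 * B1 0).
Proof.
move=> dA dA1 dB dB1 dC dC1 le0 eq0; rewrite -subr_ge0.
pose f : R -> R := cst k * (A * B) - cst l * (C * C).
pose f' : R -> R := cst k * (A1 * B + A * B1) - cst l * (C1 * C + C * C1).
apply: (@second_derive_at_min _ f f').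
- move=> t; apply: is_derive_eq; rewrite /f' !fctE /GRing.scale/=; ring.
- apply: is_derive_eq; rewrite !fctE /GRing.scale/=; ring.
- by move=> t; rewrite /f !fctE /= eq0 subrr subr_ge0.
Qed.

(** * Lattice sums as Laplace transforms *)

Section Lattice.
Context {R : realType} {n : nat} (b : n.-tuple 'cV[R]_n).
Hypothesis hb : free b.
Local Notation I := {ffun 'I_n -> int}.

Definition lattice_vec (z : I) : 'cV[R]_n := \sum_(i < n) b`_i *~ z i.

Lemma lattice_vecD z z' : lattice_vec (z + z') = lattice_vec z + lattice_vec z'.
Proof.
by rewrite /lattice_vec -big_split; apply: eq_bigr => i _; rewrite ffunE mulrzDr.
Qed.

Lemma lattice_vecB z z' : lattice_vec (z - z') = lattice_vec z - lattice_vec z'.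
Proof. by apply/eqP; rewrite eq_sym subr_eq -lattice_vecD subrK. Qed.

Lemma coord_lattice_vec z i : coord b i (lattice_vec z) = (z i)%:~R.
Proof.
rewrite /lattice_vec.
under eq_bigr do rewrite -scaler_int.
exact: coord_sum_free.
Qed.

Lemma lattice_vec_inj : injective lattice_vec.
Proof.
move=> z z' E; apply/ffunP => i; apply: (@intr_inj R).
by rewrite -!coord_lattice_vec E.
Qed.

(** The coordinates in the basis [b] are linear forms, hence bounded with respect to [norm1]; [A]
    adds up the absolute values of all their coefficients. *)
Lemma norm1_lattice_vec_ge : exists2 K : R, 0 <= K &
  forall z : I, \sum_(i < n) (`|z i|%N)%:R <= K * norm1 (lattice_vec z).
Proof.
pose A := \sum_(i < n) \sum_(j < n) `|coord b i (delta_mx j 0)|.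
exists A; first by apply: sumr_ge0 => i _; apply: sumr_ge0.
move=> z; rewrite /A mulr_suml; apply: ler_sum => i _.
have -> : (`|z i|%N)%:R = `|coord b i (lattice_vec z)|.
  by rewrite coord_lattice_vec -intr_norm -abszE.
set w := lattice_vec z.
have -> : coord b i w = \sum_(j < n) w j 0 * coord b i (delta_mx j 0).
  rewrite {1}[w]matrix_sum_delta linear_sum; apply: eq_bigr => j _.
  by rewrite big_ord1 linearZ.
rewrite (le_trans (ler_norm_sum _ _ _))// mulr_suml.
apply: ler_sum => j _; rewrite normrM mulrC ler_wpM2l//.
by rewrite /norm1 (bigD1 j)//= lerDl sumr_ge0.
Qed.

Definition freq (z : I) : 'cV[R]_n := (-2 * pi) *: lattice_vec z.

Lemma norm1_freq z : norm1 (freq z) = 2 * pi * norm1 (lattice_vec z).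
Proof.
rewrite /norm1 mulr_sumr; apply: eq_bigr => i _.
by rewrite mxE normrM mulNr normrN (@ger0_norm _ (2 * pi))// mulr_ge0// pi_ge0.
Qed.

(** Since 2 pi >= 1, the term is at most expR (- \sum_i |z i|), and expR 1 >= 2 bounds this by the
    product of powers of 1/2. This discharges the section hypothesis [hu] for [freq]. *)
Lemma asum_expR_freq : exists K, asum (fun z => expR (- K * norm1 (freq z))).
Proof.
have [K K0 hK] := norm1_lattice_vec_ge.
exists K; apply: asum_le (asum_prod_half R n) _ => z.
rewrite !ger0_norm ?expR_ge0//; last first.
  by apply: prodr_ge0 => i _; rewrite exprn_ge0// invr_ge0.
apply: (@le_trans _ _ (expR (- \sum_(i < n) (`|z i|%N)%:R))).
  rewrite ler_expR mulNr lerN2 (le_trans (hK z))// ler_wpM2l// norm1_freq.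
  by rewrite ler_peMl ?norm1_ge0//; have := pi_ge2 R; lra.
rewrite -sumrN expR_sum; apply: ler_prod => i _; rewrite expR_ge0/=.
rewrite -mulrN1 expRM_natl lerXn2r ?nnegrE ?expR_ge0 ?invr_ge0//.
by rewrite expRN lef_pV2 ?posrE ?expR_gt0//; have := expR_ge1Dx (1 : R); lra.
Qed.

(** Used at two widths: a = pi for [gwt] and a = pi / 2 for [half_gauss]. *)
Lemma rapid_gauss (a : R) : 0 < a ->
  rapid freq (fun z => expR (- a * sqnorm (lattice_vec z))).
Proof.
move=> a0 K; exists (expR ((2 * pi * K) ^+ 2 / (4 * a)) ^+ n).
  by rewrite exprn_ge0// expR_ge0.
move=> z; rewrite ger0_norm ?expR_ge0// norm1_freq.
have -> : - K * (2 * pi * norm1 (lattice_vec z)) =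
  - (2 * pi * K) * norm1 (lattice_vec z) by ring.
exact: expR_sqnorm_le.
Qed.

Definition gwt (z : I) : R := rho (lattice_vec z).

Lemma rapid_gwt : rapid freq gwt.
Proof.
rewrite /gwt; under eq_fun do rewrite rhoE.
exact: rapid_gauss (pi_gt0 R).
Qed.

(** The function Z of the overview. *)
Definition mass : 'cV[R]_n -> R := laplace freq gwt.

Lemma asum_rapid_expR c x : rapid freq c ->
  asum (fun z => c z * expR (cvdot (freq z) x)).
Proof. by move=> rc; exact (rapid_asum asum_expR_freq (rapid_expR x rc)). Qed.

Lemma mass_psum x :
  mass x = psum (fun z => gwt z * expR (cvdot (freq z) x)).
Proof.
rewrite /mass /laplace ge0_rsum//.
  exact: asum_rapid_expR rapid_gwt.
by move=> z; rewrite mulr_ge0 ?expR_ge0.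
Qed.

Lemma mass_gt0 x : 0 < mass x.
Proof.
rewrite mass_psum (@psum_gt0 _ _ _ 0)//.
- exact: asum_rapid_expR rapid_gwt.
- by move=> z; rewrite mulr_ge0 ?expR_ge0.
- by rewrite mulr_gt0 ?expR_gt0.
Qed.

Lemma rho_set_translate x :
  rho_set (translate (range lattice_vec) x) = rho x * mass x.
Proof.
have -> : translate (range lattice_vec) x =
    (fun z => lattice_vec z + x) @` [set: I].
  rewrite /translate; apply/seteqP; split => y /=.
    by move=> [_ [z _ <-] <-]; exists z.
  by move=> [z _ <-]; exists (lattice_vec z) => //; exists z.
rewrite /rho_set esum_image; last first.
  by move=> z z' _ _ /addIr /lattice_vec_inj.
rewrite mass_psum -psumZ ?expR_ge0//.
- by congr fine; apply: eq_esum => z _; rewrite rhoD.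
- by move=> z; rewrite mulr_ge0 ?expR_ge0.
- exact: asum_rapid_expR rapid_gwt.
Qed.

Lemma periodic_gaussianE x :
  periodic_gaussian (range lattice_vec) x = rho x * mass x / mass 0.
Proof.
rewrite /periodic_gaussian rho_set_translate; congr (_ / _).
have := rho_set_translate 0; rewrite rho0 mul1r => <-; congr rho_set.
apply/seteqP; split => y /=; first by exists y; rewrite ?addr0.
by move=> [w hw <-]; rewrite addr0.
Qed.

(** * The rotation identity and the resulting inequality for [mass] *)

Definition half_gauss x (z : I) : R :=
  expR (- (pi / 2) * sqnorm (lattice_vec z)) * expR (cvdot (freq z) (2^-1 *: x)).

Lemma half_gauss_ge0 x z : 0 <= half_gauss x z.
Proof. by rewrite mulr_ge0 ?expR_ge0. Qed.

Lemma asum_half_gauss x : asum (half_gauss x).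
Proof.
apply: asum_rapid_expR (rapid_gauss _).
by rewrite divr_gt0 ?pi_gt0.
Qed.

(** The parallelogram law doubles the quadratic part, and (w + w').(x + y) + (w - w').(x - y) = 2
    (w.x + w'.y) doubles the linear part; the halves in [half_gauss] compensate for both. *)
Lemma gauss_rotate x y z z' :
  gwt z * expR (cvdot (freq z) x) * (gwt z' * expR (cvdot (freq z') y)) =
  half_gauss (x + y) (z + z') * half_gauss (x - y) (z - z').
Proof.
rewrite /half_gauss /gwt !rhoE -!expRD /freq lattice_vecD lattice_vecB.
set w := lattice_vec z; set w' := lattice_vec z'.
rewrite -[- w']scaleN1r -[- y]scaleN1r !sqnormD !sqnormZ.
rewrite !(cvdotZl, cvdotZr, cvdotDl, cvdotDr).
by congr expR; field.
Qed.

Lemma massM x y : mass x * mass y =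
  \sum_k psum_class (half_gauss (x + y)) k * psum_class (half_gauss (x - y)) k.
Proof.
rewrite !mass_psum; apply: psum_mul_rotate.
- exact: asum_rapid_expR rapid_gwt.
- exact: asum_rapid_expR rapid_gwt.
- exact: asum_half_gauss.
- exact: asum_half_gauss.
- by move=> z; rewrite mulr_ge0 ?expR_ge0.
- by move=> z; rewrite mulr_ge0 ?expR_ge0.
- exact: half_gauss_ge0.
- exact: half_gauss_ge0.
- exact: gauss_rotate.
Qed.

Lemma mass_sq_le x y :
  (mass x * mass y) ^+ 2 <= mass 0 ^+ 2 * (mass (x + y) * mass (x - y)).
Proof.
(* With second argument 0 the two factors of each term of [massM] coincide. *)
have E t : mass t * mass 0 = \sum_k psum_class (half_gauss t) k ^+ 2.
  rewrite massM addr0 subr0.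
  by apply: eq_bigr => k _; rewrite expr2.
have H := massM x y; have H1 := E (x + y); have H2 := E (x - y).
have {E} -> : mass 0 ^+ 2 * (mass (x + y) * mass (x - y)) =
    (mass (x + y) * mass 0) * (mass (x - y) * mass 0).
  by move: (mass 0) (mass (x + y)) (mass (x - y)) => m0 m1 m2; ring.
by rewrite H H1 H2; exact: sum_mul_sq_le.
Qed.

(** * Derivatives of [mass] and the second-order inequality *)

Definition mass1 v : 'cV[R]_n -> R :=
  laplace freq (fun z => gwt z * cvdot (freq z) v).

Definition mass2 v u : 'cV[R]_n -> R :=
  laplace freq (fun z => gwt z * cvdot (freq z) v * cvdot (freq z) u).

Lemma is_derive_mass x v : is_derive x v mass (mass1 v x).
Proof. exact: is_derive_laplace asum_expR_freq _ _ _ rapid_gwt. Qed.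

Lemma is_derive_mass1 x v u : is_derive x u (mass1 v) (mass2 v u x).
Proof.
exact: is_derive_laplace asum_expR_freq _ _ _ (rapid_dot v rapid_gwt).
Qed.

Lemma mass2C v u : mass2 v u = mass2 u v.
Proof.
apply/funext => x; rewrite /mass2 /laplace; congr rsum; apply/funext => z.
by rewrite [_ * _ * cvdot (freq z) u]mulrAC.
Qed.

(** Linearity in the direction, read off termwise; it expresses derivatives along [v] through
    partial derivatives, hence through gradient and Hessian entries. *)
Lemma laplace_cvdot c v x : rapid freq c ->
  laplace freq (fun z => c z * cvdot (freq z) v) x =
  \sum_(i < n) v i 0 * laplace freq (fun z => c z * cvdot (freq z) (delta_mx i 0)) x.
Proof.
move=> rc.
have sc i : asum (fun z => c z * cvdot (freq z) (delta_mx i 0) * expR (cvdot (freq z) x)).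
  exact: asum_rapid_expR (rapid_dot _ rc).
rewrite /laplace; under eq_bigr => i _ do rewrite -rsumZ//.
rewrite -rsum_sum; last by move=> i; exact: asumZ.
congr rsum; apply/funext => z.
rewrite {1}/cvdot mulr_sumr mulr_suml; apply: eq_bigr => i _.
by rewrite cvdot_delta; ring.
Qed.

Lemma mass1_sum v x : mass1 v x = \sum_(i < n) v i 0 * mass1 (delta_mx i 0) x.
Proof. exact: laplace_cvdot rapid_gwt. Qed.

Lemma mass2_sum v x : mass2 v v x =
  \sum_(i < n) \sum_(j < n) v i 0 * v j 0 * mass2 (delta_mx j 0) (delta_mx i 0) x.
Proof.
rewrite {1}/mass2 laplace_cvdot; last exact: rapid_dot rapid_gwt.
apply: eq_bigr => i _.
have -> : laplace freq (fun z => gwt z * cvdot (freq z) v *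
    cvdot (freq z) (delta_mx i 0)) x = mass2 (delta_mx i 0) v x.
  by rewrite mass2C.
rewrite /mass2 laplace_cvdot; last exact: rapid_dot rapid_gwt.
rewrite mulr_sumr; apply: eq_bigr => j _.
by rewrite mulrA -/(mass2 (delta_mx i 0) (delta_mx j 0) x) mass2C.
Qed.

Lemma mass1N v x : mass1 (- v) x = - mass1 v x.
Proof.
rewrite /mass1 /laplace -rsumN; last first.
  exact: asum_rapid_expR (rapid_dot _ rapid_gwt).
congr rsum; apply/funext => z.
by rewrite -scaleN1r cvdotZr; ring.
Qed.

Lemma mass2N v x : mass2 (- v) (- v) x = mass2 v v x.
Proof.
rewrite /mass2 /laplace; congr rsum; apply/funext => z.
by rewrite -scaleN1r cvdotZr; ring.
Qed.

(** The contact lemma with A and B the values of [mass] at x + t v and x - t v, and C its value at t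
    v; [mass_sq_le] gives the inequality, an equality at t = 0. *)
Lemma mass_second_order x v :
  mass x ^+ 2 * mass2 v v 0 / mass 0 <= mass x * mass2 v v x - mass1 v x ^+ 2.
Proof.
have M0 := mass_gt0 0; have Mx := mass_gt0 x.
have dm y u t : is_derive (t : R) 1 (fun t => mass (t *: u + y)) (mass1 u (t *: u + y)).
  by apply: is_derive_along; exact: is_derive_mass.
have dm1 y u : is_derive (0 : R) 1 (fun t => mass1 u (t *: u + y)) (mass2 u u y).
  by apply: is_derive_along; rewrite scale0r add0r; exact: is_derive_mass1.
have := second_derive_contact (dm x v) (dm1 x v) (dm x (- v)) (dm1 x (- v))
  (dm 0 v) (dm1 0 v).
move=> /(_ (mass 0 ^+ 2) (mass x ^+ 2)).
rewrite !scale0r !add0r mass1N mass2N => H.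
have {}H := H _ _.
rewrite ler_pdivrMr//.
have : mass x ^+ 2 * (2 * mass 0 * mass2 v v 0 + 2 * mass1 v 0 ^+ 2) <=
  mass 0 ^+ 2 * (mass x * mass2 v v x + mass x * mass2 v v x + 2 * mass1 v x * - mass1 v x).
  apply: H; last by ring.
  move=> t; have := mass_sq_le x (t *: v).
  rewrite [x + _]addrC [x - _]addrC -scalerN addr0.
  by apply: le_trans; rewrite exprMn !expr2.
have : 0 <= 2 * (mass x * mass1 v 0) ^+ 2 by rewrite mulr_ge0// sqr_ge0.
move: (mass1 v 0) (mass2 v v 0) (mass1 v x) (mass2 v v x) => p q r s h1 h2.
(* Multiplied by 2 * mass 0, the gap to be bounded is the gap of the contact inequality plus the
   square containing [mass1 v 0]. *)
rewrite -subr_ge0 -(pmulr_rge0 _ (mulr_gt0 (ltr0Sn R 1) M0)).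
have -> : 2 * mass 0 * ((mass x * s - r ^+ 2) * mass 0 - mass x ^+ 2 * q) =
  mass 0 ^+ 2 * (mass x * s + mass x * s + 2 * r * - r) -
  mass x ^+ 2 * (2 * mass 0 * q + 2 * p ^+ 2) + 2 * (mass x * p) ^+ 2 by ring.
by rewrite addr_ge0// subr_ge0.
Qed.

(** * From [mass] back to the periodic Gaussian *)

Lemma is_derive_rhoM (g : 'cV[R]_n -> R) (g' : R) x v : is_derive x v g g' ->
  is_derive x v (fun y => rho y * g y / mass 0)
    (rho x * (g' - 2 * pi * cvdot x v * g x) / mass 0).
Proof.
move=> dg; have dr := is_derive_rho x v.
have -> : (fun y => rho y * g y / mass 0) = @rho R n * g * cst (mass 0)^-1 by [].
by apply: is_derive_eq; rewrite !fctE /GRing.scale/=; ring.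
Qed.

Local Notation f := (periodic_gaussian (range lattice_vec)).

Lemma periodic_gaussian_funE : f = (fun x => rho x * mass x / mass 0).
Proof. by apply/funext => x; exact: periodic_gaussianE. Qed.

Lemma derive_periodic_gaussian v x : derive f x v =
  rho x * (mass1 v x - 2 * pi * cvdot x v * mass x) / mass 0.
Proof.
rewrite periodic_gaussian_funE.
by have [_ E] := is_derive_rhoM (is_derive_mass x v); exact: E.
Qed.

Lemma derive2_periodic_gaussian u v x : derive (derive f ^~ v) x u =
  rho x * (mass2 v u x - 2 * pi * (cvdot u v * mass x + cvdot x v * mass1 u x)
    - 2 * pi * cvdot x u * (mass1 v x - 2 * pi * cvdot x v * mass x)) / mass 0.
Proof.
(* The first derivative again has the form rho * g / mass 0, so [is_derive_rhoM] applies a second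
   time. *)
pose g : 'cV[R]_n -> R := fun x => mass1 v x - 2 * pi * cvdot x v * mass x.
have -> : (derive f ^~ v) = (fun y => rho y * g y / mass 0).
  by apply/funext => y; exact: derive_periodic_gaussian.
have d1 := is_derive_mass1 x v u; have d2 := is_derive_mass x u.
have d3 := is_derive_cvdot x u v.
have dg : is_derive x u g
    (mass2 v u x - 2 * pi * (cvdot u v * mass x + cvdot x v * mass1 u x)).
  have -> : g = mass1 v - cst (2 * pi) * (fun y => cvdot y v) * mass by [].
  by apply: is_derive_eq; rewrite !fctE /GRing.scale/=; ring.
by have [_ E] := is_derive_rhoM dg; exact: E.
Qed.

(** All contributions of [rho] cancel: the term -2 pi u.v occurs at both x and 0, and the other
    terms in pi match those of the gradient product. *)
Lemma hessian_gap_entry u v x :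
  (f x)^-1 * derive (derive f ^~ v) x u -
    (derive (derive f ^~ v) 0 u + (f x ^+ 2)^-1 * (derive f x u * derive f x v)) =
  mass2 v u x / mass x - mass1 u x * mass1 v x / mass x ^+ 2 - mass2 v u 0 / mass 0.
Proof.
have M0 := lt0r_neq0 (mass_gt0 0); have Mx := lt0r_neq0 (mass_gt0 x).
have r0 : rho x != 0 by rewrite lt0r_neq0// expR_gt0.
have z0 y : cvdot (0 : 'cV[R]_n) y = 0 by rewrite cvdotC cvdot0.
rewrite (derive2_periodic_gaussian u v x) (derive2_periodic_gaussian u v 0).
rewrite (derive_periodic_gaussian u x) (derive_periodic_gaussian v x).
rewrite (periodic_gaussianE x) rho0 (z0 u) (z0 v).
move: M0 Mx r0; move: (mass 0) (mass x) (rho x) (mass2 v u 0) (mass2 v u x)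
  (mass1 v x) (mass1 u x) (mass1 v 0) (mass1 u 0) => *.
by field; apply/and3P.
Qed.

Lemma periodic_gaussian_loewner x :
  loewner_ge ((f x)^-1 *: hessian f x)
    (hessian f 0 + (f x ^+ 2)^-1 *: (gradient f x *m (gradient f x)^T)).
Proof.
rewrite /loewner_ge; set M := (X in psdmx X).
pose Q u v := mass2 v u x / mass x - mass1 u x * mass1 v x / mass x ^+ 2
  - mass2 v u 0 / mass 0.
have ME i j : M i j = Q (delta_mx i 0) (delta_mx j 0).
  by rewrite /M !mxE big_ord1 !mxE /partial hessian_gap_entry.
split.
  apply/matrixP => i j; rewrite mxE !ME /Q mass2C; congr (_ - _ / _ - _).
  by rewrite mulrC.
move=> v.
have -> : (v^T *m M *m v) 0 0 = Q v v.
  have -> : (v^T *m M *m v) 0 0 =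
      \sum_(i < n) \sum_(j < n) v i 0 * v j 0 * M i j.
    rewrite mxE exchange_big/=; apply: eq_bigr => j _; rewrite mxE mulr_suml.
    by apply: eq_bigr => i _; rewrite mxE mulrAC.
  rewrite /Q 2!mass2_sum expr2 2!{1}mass1_sum.
  rewrite !mulr_suml -!sumrB; apply: eq_bigr => i _.
  rewrite mulr_sumr !mulr_suml -!sumrB; apply: eq_bigr => j _.
  by rewrite ME /Q; ring.
have := mass_second_order x v; have M0 := mass_gt0 0; have Mx := mass_gt0 x.
(* Multiplying [Q v v] by mass x ^+ 2 gives exactly the gap in [mass_second_order]. *)
rewrite -subr_ge0 -(pmulr_rge0 (Q v v) (exprn_gt0 2 Mx)) /Q.
congr (0 <= _); field; by rewrite !lt0r_neq0.
Qed.

End Lattice.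

Theorem proposition3p1 (R : realType) (n : nat) (L : set 'cV[R]_n)
    (hL : is_lattice L) (x : 'cV[R]_n) :
  let f := periodic_gaussian L in
  loewner_ge ((f x)^-1 *: hessian f x)
    (hessian f 0 + (f x ^+ 2)^-1 *: (gradient f x *m (gradient f x)^T)).
Proof.
case: hL => b hb -> f; rewrite /f.
have -> : [set v | exists z : 'I_n -> int, v = \sum_(i < n) b`_i *~ z i] =
    range (lattice_vec b).
  apply/seteqP; split => v /= [z].
    move=> ->; exists (finfun z) => //; apply: eq_bigr => i _.
    by rewrite ffunE.
  by move=> _ <-; exists z.
exact: periodic_gaussian_loewner.
Qed.
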